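(* Let $N \ge 1$, let $D \subseteq \{0,1\}^N$, and let $f : D \rightarrow \{0,1\}$ be a Boolean function. For every $\epsilon \in (0,1/2)$, \[ \mathsf{rdeg}_\epsilon^+(f) \leq \mathsf{PostR}_\epsilon(f) \leq 2\, \mathsf{rdeg}_\epsilon^+(f). \]
   Context: A (deterministic) decision tree on input $x\in\{0,1\}^N$ adaptively queries bits $x_i$ and at a leaf outputs a value; its depth is the maximum number of queries on any path. A classical post-selected query algorithm $\mathcal{A}$ is a probability distribution over deterministic decision trees whose leaves are labelled $0$, $1$ or $\perp$ (''don't know''); on input $x$ it picks a tree from the distribution (independently of $x$) and outputs that tree's output on $x$. Its query complexity is the maximum depth of a tree in the support. For $\epsilon\in[0,1/2)$, $\mathcal{A}$ computes $f$ with error $\epsilon$ if for every $x\in D$, $\Pr[\mathcal{A}(x)\neq\perp]>0$ and $\Pr[\mathcal{A}(x)=f(x)\mid \mathcal{A}(x)\neq\perp]\ge 1-\epsilon$. $\mathsf{PostR}_\epsilon(f)$ is the minimum query complexity of a classical post-selected query algorithm computing $f$ with error $\epsilon$. A polynomial with nonnegative coefficients in the literals is a polynomial in the $2N$ variables $\{x_i, (1-x_i) : i\in[N]\}$, i.e. a nonnegative linear combination of monomials $\prod_{i\in S}x_i\prod_{j\in T}(1-x_j)$, whose degree is the maximum of $|S|+|T|$ over monomials with nonzero coefficient. A rational function with positive coefficients is $P/Q$ where $P,Q$ are such polynomials and $Q$ is nonzero on all inputs; its degree is $\max(\deg P,\deg Q)$. $P/Q$ $\epsilon$-approximates $f$ if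 $|P(x)/Q(x)-f(x)|\le\epsilon$ for all $x\in D$. $\mathsf{rdeg}^+_\epsilon(f)$ is the minimum degree of a rational function with positive coefficients that $\epsilon$-approximates $f$. *)

(* Defs.v *)
From HB Require Import structures.
From mathcomp Require Import all_boot all_order all_algebra finmap.
From mathcomp Require Import boolp reals.

Set Implicit Arguments.
Unset Strict Implicit.
Unset Printing Implicit Defensive.

Import Order.TTheory GRing.Theory Num.Theory.

Local Open Scope ring_scope.

Notation bits N := {ffun 'I_N -> bool}.

(* A Boolean function on the domain D: it has no value outside D. *)
Definition bfun (N : nat) (D : {set bits N}) : Type :=
  {x : bits N | x \in D} -> bool.

(* The label None is the output "don't know". *)
Inductive dtree (N : nat) : Type :=
| Leaf of option bool
| Query of 'I_N & dtree N & dtree N.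
Arguments Leaf {N} _.

Section DtreeChoice.
Variable N : nat.

Fixpoint dtree_encode (t : dtree N) : GenTree.tree ('I_N + option bool) :=
  match t with
  | Leaf o => GenTree.Leaf (inr o)
  | Query i t0 t1 =>
      GenTree.Node 0 [:: GenTree.Leaf (inl i); dtree_encode t0; dtree_encode t1]
  end.

Fixpoint dtree_decode (g : GenTree.tree ('I_N + option bool)) :
    option (dtree N) :=
  match g with
  | GenTree.Leaf (inr o) => Some (Leaf o)
  | GenTree.Node _ [:: GenTree.Leaf (inl i); g0; g1] =>
      if dtree_decode g0 is Some t0 then
        if dtree_decode g1 is Some t1 then Some (Query i t0 t1) else None
      else None
  | _ => None
  end.

Lemma dtree_encodeK : pcancel dtree_encode dtree_decode.
Proof. by elim=> //= i t0 -> t1 ->. Qed.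

HB.instance Definition _ := Countable.copy (dtree N) (pcan_type dtree_encodeK).
End DtreeChoice.

(* Query i t0 t1 continues with t0 if x_i = 0 and with t1 if x_i = 1. *)
Fixpoint run (N : nat) (t : dtree N) (x : bits N) : option bool :=
  match t with
  | Leaf o => o
  | Query i t0 t1 => if x i then run t1 x else run t0 x
  end.

Fixpoint depth (N : nat) (t : dtree N) : nat :=
  match t with
  | Leaf _ => 0
  | Query _ t0 t1 => (maxn (depth t0) (depth t1)).+1
  end.

(* Only finitely many trees have depth at most a given d, so every probability
   distribution for which the maximum depth in the support exists is finitely
   supported. *)
Record post_alg (R : realType) (N : nat) := PostAlg {
  weight :> {fsfun dtree N -> R with 0};
  weight_ge0 : forall t, 0 <= weight t;
  weight_sum1 : \sum_(t <- finsupp weight) weight t = 1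
}.

Definition query_complexity (R : realType) (N : nat) (A : post_alg R N) : nat :=
  \max_(t <- finsupp A) depth t.

Definition prob (R : realType) (N : nat) (A : post_alg R N) (x : bits N)
    (E : pred (option bool)) : R :=
  \sum_(t <- finsupp A | E (run t x)) A t.

Definition cond_prob (R : realType) (N : nat) (A : post_alg R N) (x : bits N)
    (E F : pred (option bool)) : R :=
  prob A x (predI E F) / prob A x F.

Definition post_computes (R : realType) (N : nat) (D : {set bits N})
    (f : bfun D) (eps : R) (A : post_alg R N) : Prop :=
  forall x : {x : bits N | x \in D},
    0 < prob A (val x) (predC1 None) /\
    1 - eps <= cond_prob A (val x) (pred1 (Some (f x))) (predC1 None).

(* The coefficient at (S, T) is that of the monomial
   prod_{i in S} x_i * prod_{j in T} (1 - x_j); these are formal polynomials in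
   the 2N literals, so S and T need not be disjoint. *)
Record pos_poly (R : realType) (N : nat) := PosPoly {
  pcoef :> {ffun {set 'I_N} * {set 'I_N} -> R};
  pcoef_ge0 : forall m, 0 <= pcoef m
}.

Definition peval (R : realType) (N : nat) (P : pos_poly R N) (x : bits N) : R :=
  \sum_m P m * (\prod_(i in m.1) (x i)%:R * \prod_(j in m.2) (1 - (x j)%:R)).

Definition pdeg (R : realType) (N : nat) (P : pos_poly R N) : nat :=
  \max_(m | P m != 0) (#|m.1| + #|m.2|).

(* The inputs on which Q must not vanish are the inputs of f, i.e. the points
   of D; elsewhere Q may vanish, just as Pr[A(x) <> None] may. *)
Definition rat_approximates (R : realType) (N : nat) (D : {set bits N})
    (f : bfun D) (eps : R) (P Q : pos_poly R N) : Prop :=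
  (forall x : {x : bits N | x \in D}, peval Q (val x) != 0) /\
  (forall x : {x : bits N | x \in D},
     `| peval P (val x) / peval Q (val x) - (f x)%:R | <= eps).

Definition has_post_alg (R : realType) (N : nat) (D : {set bits N})
    (f : bfun D) (eps : R) (d : nat) : Prop :=
  exists A : post_alg R N, post_computes f eps A /\ query_complexity A = d.

Definition has_pos_rat (R : realType) (N : nat) (D : {set bits N})
    (f : bfun D) (eps : R) (d : nat) : Prop :=
  exists P Q : pos_poly R N,
    rat_approximates f eps P Q /\ maxn (pdeg P) (pdeg Q) = d.

Section Existence.
Variables (R : realType) (N : nat) (D : {set bits N}) (f : bfun D) (eps : R).
Hypothesis eps_ge0 : 0 <= eps.

Let fopt (y : bits N) : option bool := omap f (insub y).

Let foptE (x : {x : bits N | x \in D}) : fopt (val x) = Some (f x).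
Proof. by rewrite /fopt valK. Qed.

Let setb (y : bits N) (i : 'I_N) (b : bool) : bits N :=
  [ffun j => if j == i then b else y j].

Fixpoint query_all (s : seq 'I_N) (y : bits N) : dtree N :=
  if s is i :: s' then
    Query i (query_all s' (setb y i false)) (query_all s' (setb y i true))
  else Leaf (fopt y).

Let query_all_run (s : seq 'I_N) (y x : bits N) :
  (forall i, i \notin s -> y i = x i) -> run (query_all s y) x = fopt x.
Proof.
elim: s y => [|i s IHs] y yx /=; first by congr fopt; apply/ffunP => i; apply: yx.
suff H b : b = x i -> run (query_all s (setb y i b)) x = fopt x.
  by case E: (x i); apply: H.
move=> bE; apply: IHs => j jNs; rewrite ffunE; case: eqP => [->//|/eqP ji].
by apply: yx; rewrite inE negb_or ji.
Qed.

Lemma has_post_alg_ex : exists d, `[< has_post_alg f eps d >].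
Proof.
pose t : dtree N := query_all (enum 'I_N) [ffun=> false].
have tE x : run t x = fopt x.
  by apply: query_all_run => i; rewrite mem_enum.
pose w : {fsfun dtree N -> R with 0} := [fsfun u in [fset t]%fset => 1 | 0].
have wE u : w u = (u == t)%:R by rewrite fsfunE inE; case: eqP.
have supp : finsupp w = [fset t]%fset.
  apply/fsetP => u; rewrite mem_finsupp wE in_fset1.
  by case: (u == t); rewrite /= ?oner_eq0 ?eqxx.
have w_ge0 u : 0 <= w u by rewrite wE ler0n.
have w_sum1 : \sum_(u <- finsupp w) w u = 1.
  by rewrite supp big_seq_fset1 wE eqxx.
pose A := PostAlg w_ge0 w_sum1.
exists (query_complexity A); apply/asboolP; exists A; split=> // x.
have pE (E : pred (option bool)) : E (Some (f x)) -> prob A (val x) E = 1.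
  move=> Ex; rewrite /prob /= supp big_mkcond big_seq_fset1.
  by rewrite tE foptE Ex wE eqxx.
by rewrite /cond_prob !pE //= ?eqxx // divr1 ltr01 gerBl.
Qed.

Lemma has_pos_rat_ex : exists d, `[< has_pos_rat f eps d >].
Proof.
pose q : {ffun {set 'I_N} * {set 'I_N} -> R} := [ffun m => (m == (set0, set0))%:R].
pose pt (S : {set 'I_N}) : bits N := [ffun i => i \in S].
pose p : {ffun {set 'I_N} * {set 'I_N} -> R} :=
  [ffun m => ((m.2 == ~: m.1) && (fopt (pt m.1) == Some true))%:R].
have q_ge0 m : 0 <= q m by rewrite ffunE ler0n.
have p_ge0 m : 0 <= p m by rewrite ffunE ler0n.
pose Q := PosPoly q_ge0; pose P := PosPoly p_ge0.
have QE x : peval Q x = 1.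
  rewrite /peval (bigD1 (set0, set0)) //= !big_set0 big1 => [|m /negPf m0].
    by rewrite ffunE eqxx !mulr1 addr0.
  by rewrite ffunE m0 mul0r.
have PE x : peval P x = (fopt x == Some true)%:R.
  pose S := [set i | x i].
  have ptS : pt S = x by apply/ffunP => i; rewrite ffunE inE.
  rewrite /peval (bigD1 (S, ~: S)) //= [X in _ + X]big1 => [|[U V] /= UV].
    rewrite ffunE /= eqxx ptS addr0 !big1 ?mulr1 // => i; rewrite !inE.
      by move=> /negPf ->; rewrite subr0.
    by move=> ->.
  rewrite ffunE /=; have [VE|_] := eqVneq V (~: U); last by rewrite mul0r.
  have US : U != S by apply: contraNneq UV => US; rewrite VE US.
  have [i iUS] : exists i, (i \in U) != x i.
    apply/existsP; apply: contraNT US => /existsPn H.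
    by apply/eqP/setP => i; rewrite inE; apply/eqP/negPn/H.
  case iU: (i \in U) iUS => xi.
    rewrite (bigD1 i iU) /=; have -> : x i = false by case: (x i) xi.
    by rewrite !mul0r mulr0.
  have iV : i \in V by rewrite VE inE iU.
  rewrite [X in _ * (_ * X)](bigD1 i iV) /=.
  have -> : x i = true by case: (x i) xi.
  by rewrite subrr mul0r !mulr0.
exists (maxn (pdeg P) (pdeg Q)); apply/asboolP; exists P, Q; split=> //.
split=> x; first by rewrite QE oner_eq0.
by rewrite QE PE foptE divr1; case: (f x); rewrite subrr normr0.
Qed.

End Existence.

Definition PostR (R : realType) (N : nat) (D : {set bits N}) (f : bfun D)
    (eps : R) (eps_ge0 : 0 <= eps) : nat :=
  ex_minn (has_post_alg_ex f eps_ge0).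

Definition rdeg_plus (R : realType) (N : nat) (D : {set bits N}) (f : bfun D)
    (eps : R) (eps_ge0 : 0 <= eps) : nat :=
  ex_minn (has_pos_rat_ex f eps_ge0).

(* Main.v *)
(** If [A] is a post-selected algorithm, then [Pr[A(x) = 1]] and
    [Pr[A(x) <> None]] are sums, over the root-to-leaf paths of the trees of
    [A], of nonnegative multiples of the monomial of literals met on the path;
    their quotient approximates [f].

    Conversely, let [r = P/Q] approximate [f]. An algorithm that samples a
    monomial with probability proportional to its coefficient, queries its
    variables and answers [None] unless the monomial evaluates to 1 realizes any
    pair of positive polynomials as the unnormalized probabilities of the answers
    1 and 0. For the pair [P^2] and [eps (1 - eps) Q^2] the odds of the answer 1
    are [r^2 / (eps (1 - eps))], at most [eps / (1 - eps)] if [r <= eps] and at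
    least [(1 - eps) / eps] if [r >= 1 - eps]. *)

Require Import Defs.
From mathcomp Require Import all_boot all_order all_algebra.
From mathcomp Require Import reals.
From mathcomp Require Import finmap boolp zify ring lra.

Import Order.TTheory GRing.Theory Num.Theory.
Local Open Scope ring_scope.

(** * Monomials in the literals *)

Notation monomial N := ({set 'I_N} * {set 'I_N})%type.

(** Literals are idempotent on Boolean inputs, so taking unions represents the product as a
    function; shared literals make the degree drop. *)
Definition monomial_mul {N : nat} (m m' : monomial N) : monomial N :=
  (m.1 :|: m'.1, m.2 :|: m'.2).

Definition monomial_deg {N : nat} (m : monomial N) : nat := #|m.1| + #|m.2|.

Definition literal {N : nat} (i : 'I_N) (b : bool) : monomial N :=
  if b then ([set i], set0) else (set0, [set i]).
Arguments literal : simpl never.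

Definition monomial_holds {N : nat} (m : monomial N) (x : bits N) : bool :=
  [forall i in m.1, x i] && [forall i in m.2, ~~ x i].

Lemma monomial_deg_mul {N : nat} (m m' : monomial N) :
  (monomial_deg (monomial_mul m m') <= monomial_deg m + monomial_deg m')%N.
Proof. by rewrite /monomial_deg addnACA leq_add ?leq_card_setU. Qed.

Lemma monomial_deg_literal {N : nat} (i : 'I_N) (b : bool) :
  monomial_deg (literal i b) = 1%N.
Proof. by case: b; rewrite /monomial_deg /literal /= cards1 cards0. Qed.

Lemma forall_in_setU {I : finType} (A B : {set I}) (p : pred I) :
  [forall i in A :|: B, p i] = [forall i in A, p i] && [forall i in B, p i].
Proof.
apply/forall_inP/andP => [H|[/forall_inP HA /forall_inP HB] i].
  by split; apply/forall_inP => i iAB; apply: H; rewrite inE iAB ?orbT.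
by case/setUP; [apply: HA|apply: HB].
Qed.

Lemma forall_in_set1 {I : finType} (i : I) (p : pred I) :
  [forall j in [set i], p j] = p i.
Proof.
apply/forall_inP/idP => [|pi j /set1P -> //]; by apply; rewrite inE.
Qed.

Lemma forall_in_set0 {I : finType} (p : pred I) : [forall i in set0, p i].
Proof. by apply/forall_inP => i; rewrite inE. Qed.

Lemma monomial_holds_mul {N : nat} (m m' : monomial N) (x : bits N) :
  monomial_holds (monomial_mul m m') x
  = monomial_holds m x && monomial_holds m' x.
Proof. by rewrite /monomial_holds !forall_in_setU andbACA. Qed.

Lemma monomial_holds_literal {N : nat} (i : 'I_N) (b : bool) (x : bits N) :
  monomial_holds (literal i b) x = (x i == b).
Proof.
rewrite /monomial_holds /literal; case: b => /=;
  by rewrite forall_in_set1 forall_in_set0 ?andbT ?eqb_id ?eqbF_neg.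
Qed.

(** * Evaluation and construction of positive polynomials *)

Lemma prod_natb {R : realType} {I : finType} (A : {set I}) (b : pred I) :
  \prod_(i in A) (b i)%:R = [forall i in A, b i]%:R :> R.
Proof.
have [/forall_inP H|] := boolP [forall i in A, b i].
  by rewrite big1 // => i /H ->.
rewrite negb_forall_in => /exists_inP[i iA /negPf bi].
by rewrite (bigD1 i) //= bi mul0r.
Qed.

Lemma pevalE {R : realType} {N : nat} (P : pos_poly R N) (x : bits N) :
  peval P x = \sum_(m | monomial_holds m x) P m.
Proof.
rewrite /peval [RHS]big_mkcond; apply: eq_bigr => m _.
have -> : \prod_(j in m.2) (1 - (x j)%:R) = \prod_(j in m.2) (~~ x j)%:R :> R.
  by apply: eq_bigr => j _; case: (x j); rewrite ?subrr ?subr0.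
rewrite !(prod_natb _ (fun i => _)) -natrM mulnb -/(monomial_holds m x).
by case: monomial_holds; rewrite ?mulr1 ?mulr0.
Qed.

Lemma peval_ge0 {R : realType} {N : nat} (P : pos_poly R N) (x : bits N) :
  0 <= peval P x.
Proof. by rewrite pevalE sumr_ge0 // => m _; apply: pcoef_ge0. Qed.

(** Adding the weights of equal monomials turns a list of terms, with possible repetitions, into a
    positive polynomial. It serves both for products and for sums over paths of trees. *)
Lemma pos_poly_of_family {R : realType} {N : nat} {I : eqType} (s : seq I)
    (c : I -> R) (m : I -> monomial N) (d : nat) :
  (forall i, 0 <= c i) ->
  (forall i, i \in s -> c i != 0 -> (monomial_deg (m i) <= d)%N) ->
  exists P : pos_poly R N,
    (forall x, peval P x = \sum_(i <- s | monomial_holds (m i) x) c i) /\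
    (pdeg P <= d)%N.
Proof.
move=> c_ge0 deg_le.
pose p : {ffun monomial N -> R} := [ffun u => \sum_(i <- s | m i == u) c i].
have p_ge0 u : 0 <= p u by rewrite ffunE sumr_ge0.
exists (PosPoly p_ge0); split => [x|].
  rewrite pevalE; under eq_bigr do rewrite ffunE.
  rewrite (exchange_big_dep (fun i => monomial_holds (m i) x)) /=; last first.
    by move=> u i ux /eqP ->.
  apply: eq_bigr => i ix; rewrite (big_pred1 (m i)) // => u.
  by rewrite /= eq_sym; case: eqP => [->|_]; rewrite ?ix ?andbF.
apply/bigmax_leqP => u; rewrite /= ffunE => pu.
(* A nonzero coefficient at [u] comes from at least one term of nonzero weight, whose degree is
   bounded by assumption. *)
have {pu} /hasP[i si /andP[/eqP <- ci]] : has (fun i => (m i == u) && (c i != 0)) s.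
  apply: contraNT pu => /hasPn H; rewrite big1_seq // => i /andP[iu si].
  by move: (H i si); rewrite iu negbK => /eqP.
exact: deg_le.
Qed.

Lemma pos_poly_scale_mul {R : realType} {N : nat} (c : R) (P Q : pos_poly R N) :
  0 <= c ->
  exists PQ : pos_poly R N,
    (forall x, peval PQ x = c * (peval P x * peval Q x)) /\
    (pdeg PQ <= pdeg P + pdeg Q)%N.
Proof.
move=> c_ge0.
have [|u _|PQ [PQE PQdeg]] := @pos_poly_of_family R N _
    (index_enum (monomial N * monomial N)%type)
    (fun u => c * (P u.1 * Q u.2)) (fun u => monomial_mul u.1 u.2)
    (pdeg P + pdeg Q).
- by move=> u; rewrite !mulr_ge0 ?pcoef_ge0.
- rewrite !mulf_eq0 !negb_or => /andP[_ /andP[Pu Qu]].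
  apply: leq_trans (monomial_deg_mul _ _) (leq_add _ _).
    exact: (@leq_bigmax_cond _ (fun m => P m != 0) (@monomial_deg N)).
  exact: (@leq_bigmax_cond _ (fun m => Q m != 0) (@monomial_deg N)).
exists PQ; split=> // x; rewrite PQE -mulr_sumr !pevalE big_distrlr /=.
by rewrite pair_big; congr (_ * _); apply: eq_bigl => u; rewrite monomial_holds_mul.
Qed.

(** * From decision trees to polynomials *)

(** A path that queries a variable twice with opposite answers is kept: its monomial contains both
    literals and never holds. *)
Fixpoint paths {N : nat} (t : dtree N) : seq (monomial N * option bool) :=
  match t with
  | Leaf o => [:: ((set0, set0), o)]
  | Query i t0 t1 =>
      [seq (monomial_mul (literal i false) p.1, p.2) | p <- paths t0] ++
      [seq (monomial_mul (literal i true) p.1, p.2) | p <- paths t1]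
  end.

Lemma paths_depth {N : nat} (t : dtree N) (p : monomial N * option bool) :
  p \in paths t -> (monomial_deg p.1 <= depth t)%N.
Proof.
elim: t p => [o|i t0 IH0 t1 IH1] p /=.
  by rewrite inE => /eqP -> /=; rewrite /monomial_deg !cards0.
rewrite mem_cat => /orP[] /mapP[q qt ->] /=;
  apply: leq_trans (monomial_deg_mul _ _) _; rewrite monomial_deg_literal ltnS.
- by rewrite leq_max IH0.
- by rewrite leq_max IH1 ?orbT.
Qed.

(** Exactly one path of [t] is consistent with [x], and its label is [run t x]; hence the count is 0
    or 1. *)
Lemma count_paths {N : nat} (t : dtree N) (E : pred (option bool))
    (x : bits N) :
  count (fun p => monomial_holds p.1 x && E p.2) (paths t) = E (run t x).
Proof.
elim: t => [o|i t0 IH0 t1 IH1] /=.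
  by rewrite /monomial_holds !forall_in_set0 addn0.
have countE b t : count (preim (fun p => (monomial_mul (literal i b) p.1, p.2))
      (fun p => monomial_holds p.1 x && E p.2)) (paths t)
    = ((x i == b) * count (fun p => monomial_holds p.1 x && E p.2) (paths t))%N.
  case xi: (x i == b); rewrite ?mul1n ?mul0n -?(count_pred0 (paths t));
    by apply: eq_count => p /=; rewrite monomial_holds_mul monomial_holds_literal xi.
rewrite count_cat !count_map !countE IH0 IH1.
by case: (x i); rewrite ?mul1n ?mul0n ?addn0.
Qed.

Lemma pos_poly_of_prob {R : realType} {N : nat} (A : post_alg R N)
    (E : pred (option bool)) :
  exists P : pos_poly R N,
    (forall x, peval P x = prob A x E) /\ (pdeg P <= query_complexity A)%N.
Proof.
pose s := [seq (t, p) | t <- finsupp A, p <- [seq p <- paths t | E p.2]].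
have [|u|P [PE Pdeg]] := @pos_poly_of_family R N _ s
    (fun u => A u.1) (fun u => u.2.1) (query_complexity A).
- by move=> u; apply: weight_ge0.
- case/allpairsPdep => t [p [tA pt ->]] _ /=.
  move: pt; rewrite mem_filter => /andP[_ /paths_depth] /leq_trans; apply.
  exact: leq_bigmax_seq.
exists P; split=> // x; rewrite PE big_mkcond big_allpairs_dep /= /prob.
rewrite [RHS]big_mkcond; apply: eq_bigr => t _.
(* For a fixed tree the summand [A t] is constant, so the inner sum is [A t] times the number of
   consistent paths with label in [E]. *)
rewrite -big_mkcond big_filter_cond /= big_const_seq iter_addr_0.
under eq_count do rewrite andbC.
by rewrite count_paths; case: (E _).
Qed.

(** * From weighted trees and polynomials to algorithms *)

(** The distribution is the push-forward of the normalized weights along [T]: as [T] may be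
    non-injective, a tree receives the total weight of its fibre. *)
Lemma post_alg_of_family {R : realType} {N : nat} {I : finType}
    (T : I -> dtree N) (w : I -> R) :
  (forall i, 0 <= w i) -> 0 < \sum_i w i ->
  exists A : post_alg R N,
    (forall x E,
       prob A x E = (\sum_(i | E (run (T i) x)) w i) / \sum_i w i) /\
    (forall d, (forall i, w i != 0 -> (depth (T i) <= d)%N) ->
       (query_complexity A <= d)%N).
Proof.
move=> w_ge0; set W := \sum_i w i => W_gt0.
pose v : {fsfun dtree N -> R with 0} :=
  [fsfun t in [fset T i | i in I]%fset => (\sum_(i | T i == t) w i) / W | 0].
have vE t : v t = (\sum_(i | T i == t) w i) / W.
  rewrite fsfunE; case: ifPn => // tNT; rewrite big_pred0 ?mul0r // => i.
  by apply: contraNF tNT => /eqP <-; apply/imfsetP; exists i.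
have v_ge0 t : 0 <= v t by rewrite vE divr_ge0 ?sumr_ge0 ?ltW.
have suppP t : t \in finsupp v -> exists2 i, w i != 0 & T i = t.
  rewrite mem_finsupp vE => vt.
  have /existsP[i /andP[wi /eqP Ti]] : [exists i, (w i != 0) && (T i == t)].
    apply: contraNT vt => /existsPn H; rewrite big1 ?mul0r // => i iT.
    by move: (H i); rewrite iT andbT negbK => /eqP.
  by exists i.
have T_supp i : w i != 0 -> T i \in finsupp v.
  move=> wi; rewrite mem_finsupp vE mulf_neq0 ?invr_eq0 ?gt_eqF //.
  rewrite (bigD1 i) //=; apply: ltr_wpDr; first by rewrite sumr_ge0.
  by rewrite lt_def wi w_ge0.
have sumE (E : pred (dtree N)) :
    \sum_(t <- finsupp v | E t) v t = (\sum_(i | E (T i)) w i) / W.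
  under eq_bigr do rewrite vE.
  rewrite -mulr_suml; congr (_ / _).
  rewrite (exchange_big_dep (fun i => E (T i))) /=; last by move=> t i Et /eqP ->.
  (* The tree of an index of weight 0 may lie outside the support, but then both sides vanish;
     otherwise [T i] is in the support and is the only tree to which [i] contributes. *)
  apply: eq_bigr => i ETi; have [->|wi] := eqVneq (w i) 0; first by rewrite big1.
  rewrite -big_filter (bigD1_seq (T i)) ?filter_uniq ?fset_uniq //=; last first.
    by rewrite mem_filter ETi eqxx T_supp.
  rewrite big_filter_cond big_pred0 ?addr0 // => t.
  by rewrite eq_sym; case: eqP; rewrite ?andbF.
have v_sum1 : \sum_(t <- finsupp v) v t = 1.
  by rewrite (sumE predT) divff // gt_eqF.
exists (PostAlg v_ge0 v_sum1); split=> [x E|d dP].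
  by rewrite /prob (sumE (fun t => E (run t x))).
by apply/bigmax_leqP_seq => t /suppP[i wi <-] _; apply: dP.
Qed.

Fixpoint conj_tree {N : nat} (b : bool) (s : seq ('I_N * bool)) : dtree N :=
  match s with
  | [::] => Leaf (Some b)
  | (i, true) :: s' => Query i (Leaf None) (conj_tree b s')
  | (i, false) :: s' => Query i (conj_tree b s') (Leaf None)
  end.

Lemma run_conj_tree {N : nat} (b : bool) (s : seq ('I_N * bool)) (x : bits N) :
  run (conj_tree b s) x = if all (fun l => x l.1 == l.2) s then Some b else None.
Proof. by elim: s => [//|[i []] s IH] /=; rewrite IH; case: (x i). Qed.

Lemma depth_conj_tree {N : nat} (b : bool) (s : seq ('I_N * bool)) :
  depth (conj_tree b s) = size s.
Proof. by elim: s => [//|[i []] s IH] /=; rewrite IH ?max0n ?maxn0. Qed.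

Definition monomial_tree {N : nat} (b : bool) (m : monomial N) : dtree N :=
  conj_tree b ([seq (i, true) | i <- enum m.1] ++ [seq (i, false) | i <- enum m.2]).

Lemma run_monomial_tree {N : nat} (b : bool) (m : monomial N) (x : bits N) :
  run (monomial_tree b m) x = if monomial_holds m x then Some b else None.
Proof.
rewrite run_conj_tree all_cat !all_map; congr (if _ && _ then _ else _).
  by apply/allP/forall_inP => H i; have := H i; rewrite mem_enum /= eqb_id.
by apply/allP/forall_inP => H i; have := H i; rewrite mem_enum /= eqbF_neg.
Qed.

Lemma depth_monomial_tree {N : nat} (b : bool) (m : monomial N) :
  depth (monomial_tree b m) = monomial_deg m.
Proof. by rewrite depth_conj_tree size_cat !size_map -!cardE. Qed.

(** The normalization [W] is common to both answers and to all inputs, so it cancels in conditional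
    probabilities. *)
Lemma post_alg_of_pos_polys {R : realType} {N : nat} (P : bool -> pos_poly R N) :
  exists A : post_alg R N, exists2 W : R, 0 < W &
    (forall x b, prob A x (pred1 (Some b)) = peval (P b) x / W) /\
    (query_complexity A <= maxn (pdeg (P true)) (pdeg (P false)))%N.
Proof.
(* The index [None] carries a tree that always answers [None]; it keeps the
   total weight positive even if all coefficients vanish. *)
pose T (u : option (bool * monomial N)) :=
  if u is Some (b, m) then monomial_tree b m else Leaf None.
pose w (u : option (bool * monomial N)) : R := if u is Some (b, m) then P b m else 1.
have w_ge0 u : 0 <= w u by case: u => [[b m]|] /=; rewrite ?pcoef_ge0.
have W_gt0 : 0 < \sum_u w u.
  by rewrite (bigD1 None) //= ltr_pwDl ?ltr01 ?sumr_ge0.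
have [A [AE Adeg]] := post_alg_of_family T w w_ge0 W_gt0.
exists A, (\sum_u w u) => //; split=> [x b|].
  rewrite AE pevalE; congr (_ / _).
  (* Only indices of the form [Some (b, m)] can produce the answer [Some b], so the sum reduces to
     one over monomials. *)
  rewrite (reindex_omap (fun m => Some (b, m))
    (fun u => if u is Some (_, m) then Some m else None)) /=; last first.
    move=> [[b' m]|] //=; rewrite run_monomial_tree.
    by case: ifP => // _ /eqP[->].
  apply: eq_bigl => m; rewrite run_monomial_tree eqxx andbT.
  by case: monomial_holds; rewrite /= ?eqxx.
apply: Adeg => -[[b m]|] //= Pm; rewrite depth_monomial_tree.
have mP : (monomial_deg m <= pdeg (P b))%N.
  exact: (@leq_bigmax_cond _ (fun m => P b m != 0) (@monomial_deg N)).
by apply: leq_trans mP _; case: (b); rewrite ?leq_maxl ?leq_maxr.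
Qed.

(** * Conditional probabilities and the two inequalities *)

Lemma prob_answered {R : realType} {N : nat} (A : post_alg R N) (x : bits N)
    (b : bool) :
  prob A x (predC1 None)
  = prob A x (pred1 (Some b)) + prob A x (pred1 (Some (~~ b))).
Proof.
rewrite /prob (bigID (fun t => run t x == Some b)) /=.
by congr (_ + _); apply: eq_bigl => t; case: run => [[]|]; case: b.
Qed.

Lemma cond_prob_answer {R : realType} {N : nat} (A : post_alg R N) (x : bits N)
    (b : bool) :
  cond_prob A x (pred1 (Some b)) (predC1 None)
  = prob A x (pred1 (Some b)) / prob A x (predC1 None).
Proof.
rewrite /cond_prob; congr (_ / _).
by apply: eq_bigl => t /=; case: run => [[]|]; case: b.
Qed.

Lemma prob_ge0 {R : realType} {N : nat} (A : post_alg R N) (x : bits N)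
    (E : pred (option bool)) : 0 <= prob A x E.
Proof. by rewrite sumr_ge0 // => t _; apply: weight_ge0. Qed.

Lemma post_alg_to_pos_rat {R : realType} {N : nat} {D : {set bits N}}
    (f : bfun D) (eps : R) (A : post_alg R N) :
  post_computes f eps A ->
  exists2 d, has_pos_rat f eps d & (d <= query_complexity A)%N.
Proof.
move=> Af.
have [P [PE Pdeg]] := pos_poly_of_prob A (pred1 (Some true)).
have [Q [QE Qdeg]] := pos_poly_of_prob A (predC1 None).
exists (maxn (pdeg P) (pdeg Q)); last by rewrite geq_max Pdeg.
exists P, Q; split=> //; split=> x; have [A_gt0] := Af x; rewrite ?PE QE.
  by rewrite gt_eqF.
rewrite cond_prob_answer.
have := prob_answered A (val x) true; have := prob_ge0 A (val x) (pred1 (Some false)).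
set p1 := prob A _ (pred1 (Some true)); set p0 := prob A _ (pred1 (Some false)).
have := prob_ge0 A (val x) (pred1 (Some true)); rewrite -/p1.
move: A_gt0; set q := prob A _ (predC1 None) => q_gt0 p1_ge0 p0_ge0 qE.
case: (f x); rewrite -/p1 -/p0 ler_pdivlMr // => le_p; rewrite ler_norml.
  (* In either case the distance from [p1 / q] to [f x] is the conditional probability of the wrong
     answer. *)
  have -> : p1 / q - true%:R = - (p0 / q) by rewrite qE /=; field; lra.
  have : p0 / q <= eps by rewrite ler_pdivrMr //; lra.
  have : 0 <= p0 / q by rewrite divr_ge0 // ltW.
  by move=> ? ?; apply/andP; split; lra.
have : p1 / q <= eps by rewrite ler_pdivrMr //; lra.
have : 0 <= p1 / q by rewrite divr_ge0 // ltW.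
by move=> ? ?; rewrite subr0; apply/andP; split; lra.
Qed.

Lemma pos_rat_to_post_alg {R : realType} {N : nat} {D : {set bits N}}
    (f : bfun D) (eps : R) (P Q : pos_poly R N) :
  0 < eps < 1 -> rat_approximates f eps P Q ->
  exists2 A : post_alg R N, post_computes f eps A &
    (query_complexity A <= 2 * maxn (pdeg P) (pdeg Q))%N.
Proof.
move=> /andP[eps_gt0 eps_lt1] [Q_neq0 PQf].
have [P2 [P2E P2deg]] := pos_poly_scale_mul 1 P P ler01.
have c_ge0 : 0 <= eps * (1 - eps) by nra.
have [Q2 [Q2E Q2deg]] := pos_poly_scale_mul _ Q Q c_ge0.
(* Squaring both polynomials is what costs the factor 2 in the query complexity. *)
have [A [W W_gt0 [AE Adeg]]] :=
  post_alg_of_pos_polys (fun b : bool => if b then P2 else Q2).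
exists A; last by move: Adeg => /=; lia.
move=> x; rewrite cond_prob_answer (prob_answered A _ (f x)) !AE.
have q_gt0 : 0 < peval Q (val x) by rewrite lt_def Q_neq0 peval_ge0.
have p_ge0 := peval_ge0 P (val x).
have := PQf x; rewrite ler_distl ler_pdivlMr // ler_pdivrMr // => /andP[].
move: q_gt0 p_ge0; set p := peval P _; set q := peval Q _ => q_gt0 p_ge0.
set w := W^-1; have w_gt0 : 0 < w by rewrite invr_gt0.
have c_gt0 : 0 < eps * (1 - eps) by rewrite mulr_gt0 // subr_gt0.
have v_gt0 : 0 < eps * (1 - eps) * (q * q) by rewrite !mulr_gt0 // subr_gt0.
have u_ge0 : 0 <= p * p by rewrite mulr_ge0.
have uv_gt0 : 0 < p * p + eps * (1 - eps) * (q * q) by lra.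
case: (f x); rewrite /= P2E Q2E -/p -/q -mulrDl mul1r; last rewrite !add0r [_ + p * p]addrC.
  move=> p_ge _; split; first by rewrite mulr_gt0.
  rewrite ler_pdivlMr ?mulr_gt0 // [X in X <= _]mulrA ler_pM2r //.
  (* After cancelling [w], the goal amounts to [eps] times this square of the bound
     [(1 - eps) * q <= p]. *)
  have : ((1 - eps) * q) * ((1 - eps) * q) <= p * p by rewrite ler_pM // mulr_ge0 //; lra.
  by nra.
move=> _ p_le; split; first by rewrite mulr_gt0.
rewrite ler_pdivlMr ?mulr_gt0 // [X in X <= _]mulrA ler_pM2r //.
have p2_le : p * p <= (eps * q) * (eps * q) by rewrite ler_pM.
(* The goal, with all terms moved to one side, is exactly this inequality. *)
have : 0 <= (1 - eps) * ((eps * q) * (eps * q) - p * p).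
  by rewrite mulr_ge0 ?subr_ge0 // ltW.
by nra.
Qed.

Theorem theorem1 (R : realType) (N : nat) (N_ge1 : (1 <= N)%N)
    (D : {set bits N}) (f : bfun D)
    (eps : R) (eps_gt0 : 0 < eps) (eps_lt_half : eps < 1 / 2%:R) :
  (rdeg_plus f (ltW eps_gt0) <= PostR f (ltW eps_gt0))%N /\
  (PostR f (ltW eps_gt0) <= 2 * rdeg_plus f (ltW eps_gt0))%N.
Proof.
rewrite /rdeg_plus /PostR; split.
  (* An optimal algorithm yields an approximation of degree at most its complexity, which bounds the
     minimal degree; the second inequality is symmetric. *)
  case: (ex_minnP (has_post_alg_ex _ _)) => _ /asboolP[A [Af <-]] _.
  case: ex_minnP => r _ r_min.
  have [d fd dA] := post_alg_to_pos_rat f eps A Af.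
  by apply: leq_trans dA; apply/r_min/asboolP.
case: (ex_minnP (has_pos_rat_ex _ _)) => _ /asboolP[P [Q [PQf <-]]] _.
case: ex_minnP => r _ r_min.
have eps01 : 0 < eps < 1 by apply/andP; split; lra.
have [A Af /(leq_trans _)] := pos_rat_to_post_alg f eps P Q eps01 PQf.
by apply; apply/r_min/asboolP; exists A.
Qed.
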